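(* Let $a,b,c$ be positive reals with $a\neq b$, $m$ a positive integer, $k$ a nonnegative integer, $r$ a positive integer, and let $\alpha_0,\alpha_1,\alpha_2,\dots$ be complex numbers, with $\overline{\alpha}_r=(\alpha_0,\dots,\alpha_{r-1})$. Then for all real $x$ and $n\in\mathbb{N}_0$, $$M^{[m-1,r]}_{n}(x;k;a,b,c;\overline{\alpha}_{r})=\sum_{j=0}^{n}(x;\overline{\alpha})_{\underline{j}}\sum_{\ell=j}^{n}\binom{n}{n-\ell}(\ln c)^{\ell}S(\ell,j;\overline{\alpha})M^{[m-1,r]}_{n-\ell}(k;a,b,c;\overline{\alpha}_{r}).$$
   Context: $(x;\overline{\alpha})_{\underline{j}}=(x-\alpha_0)(x-\alpha_1)\cdots(x-\alpha_{j-1})$, with $(x;\overline{\alpha})_{\underline{0}}=1$. The generalized Stirling numbers of the second kind $S(\ell,j;\overline{\alpha})$ are defined by $x^{\ell}=\sum_{j=0}^{\ell}S(\ell,j;\overline{\alpha})(x;\overline{\alpha})_{\underline{j}}$ for all $\ell\in\mathbb{N}_0$. The polynomials $M^{[m-1,r]}_{n}(x;k;a,b,c;\overline{\alpha}_{r})$ are the Taylor coefficients at $t=0$ of $$\frac{t^{rkm}2^{rm(1-k)}c^{xt}}{\prod_{i=0}^{r-1}\left(\alpha_{i}b^{t}-a^{t}\sum_{p=0}^{m-1}\frac{t^{p}}{p!}\right)}=\sum_{n=0}^{\infty}M^{[m-1,r]}_{n}(x;k;a,b,c;\overline{\alpha}_{r})\frac{t^{n}}{n!},$$ the parameters being assumed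 such that this function is analytic near $t=0$; and $M^{[m-1,r]}_{n}(k;a,b,c;\overline{\alpha}_{r}):=M^{[m-1,r]}_{n}(0;k;a,b,c;\overline{\alpha}_{r})$. *)

(* Defs.v *)
(* The complex plane is Coquelicot's [C]; [Binomial.C] is the binomial
   coefficient of the standard library. *)
From Stdlib Require Import Reals Lra Lia ZArith Factorial ClassicalEpsilon.
From Coquelicot Require Import Coquelicot.

Open Scope C_scope.

(* f 0 * ... * f (n - 1), with value 1 for n = 0 *)
Fixpoint Cprod (f : nat -> C) (n : nat) : C :=
  match n with
  | O => 1
  | S p => Cprod f p * f p
  end.

Definition gen_ffact (alpha : nat -> C) (x : C) (j : nat) : C :=
  Cprod (fun i => x - alpha i) j.

Definition is_gen_stirling2 (alpha : nat -> C) (s : nat -> nat -> C) : Prop :=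
  forall (l : nat) (x : C),
    x ^ l = sum_n (fun j => s l j * gen_ffact alpha x j) l.

(* The defining identity determines the values for j <= l; those for j > l
   are left unspecified. *)
Definition gen_stirling2 (alpha : nat -> C) : nat -> nat -> C :=
  epsilon (inhabits (fun _ _ => RtoC 0)) (is_gen_stirling2 alpha).

Definition Cexp (z : C) : C :=
  (exp (Re z) * cos (Im z), exp (Re z) * sin (Im z))%R.

Definition Rpow_C (b : R) (z : C) : C := Cexp (z * ln b).

(* Only t <> 0 is considered: a quotient of functions that both vanish at 0
   is regarded as analytic at 0 when the singularity is removable, whatever
   value the total division takes there. *)
Definition is_taylor_at_0 (f : C -> C) (u : nat -> C) : Prop :=
  exists rho : R, (0 < rho)%R /\
    forall t : C, (0 < Cmod t < rho)%R ->
      is_pseries (K := C_AbsRing) (V := C_NormedModule)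
        (fun n => u n / INR (fact n)) t (f t).

Definition analytic_at_0 (f : C -> C) : Prop :=
  exists u : nat -> C, is_taylor_at_0 f u.

(* n-th derivative at 0 of (the analytic extension of) f *)
Definition taylor_coeff (f : C -> C) : nat -> C :=
  epsilon (inhabits (fun _ => RtoC 0)) (is_taylor_at_0 f).

(* The sum over 0 <= p <= m - 1 is the intended one for m > 0 only. *)
Definition exp_trunc (m : nat) (t : C) : C :=
  sum_n (fun p => t ^ p / INR (fact p)) (m - 1).

Definition M_genfun (m r k : nat) (a b c : R) (alpha : nat -> C)
    (x : R) (t : C) : C :=
  t ^ (r * k * m)
  * powerRZ 2 (Z.of_nat r * Z.of_nat m * (1 - Z.of_nat k))
  * Rpow_C c (x * t)
  / Cprod (fun i => alpha i * Rpow_C b t - Rpow_C a t * exp_trunc m t) r.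

Definition M_poly (m r k : nat) (a b c : R) (alpha : nat -> C)
    (n : nat) (x : R) : C :=
  taylor_coeff (M_genfun m r k a b c alpha x) n.

Definition M_num (m r k : nat) (a b c : R) (alpha : nat -> C) (n : nat) : C :=
  M_poly m r k a b c alpha n 0.

Lemma taylor_coeffP (f : C -> C) :
  analytic_at_0 f -> is_taylor_at_0 f (taylor_coeff f).
Proof. intros [u Hu]; apply (epsilon_spec _ (is_taylor_at_0 f)); now exists u. Qed.

Lemma gen_stirling2P (alpha : nat -> C) :
  is_gen_stirling2 alpha (gen_stirling2 alpha).
Proof.
apply (epsilon_spec _ (is_gen_stirling2 alpha)).
set (T := fix T (l : nat) : nat -> C := fun j =>
  match l, j with
  | O, O => RtoC 1
  | O, S _ => RtoC 0
  | S p, O => alpha O * T p O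
  | S p, S q => T p q + alpha (S q) * T p (S q)
  end).
assert (T0 : forall l j, (l < j)%nat -> T l j = 0).
{ induction l as [|l IH]; intros [|j] Hj; try lia; simpl.
  - reflexivity.
  - rewrite !IH by lia; ring. }
assert (step : forall l x n,
  sum_n (fun j => T (S l) j * gen_ffact alpha x j) (S n)
  = x * sum_n (fun j => T l j * gen_ffact alpha x j) n
    + alpha (S n) * T l (S n) * gen_ffact alpha x (S n)).
{ intros l x n; induction n as [|n IH].
  - rewrite sum_Sn, !sum_O; unfold gen_ffact; simpl; unfold plus; simpl; ring.
  - rewrite sum_Sn, IH, (sum_Sn _ n).
    unfold gen_ffact; simpl; unfold plus; simpl; ring. }
exists T; intros l x; induction l as [|l IH].
- rewrite sum_O; unfold gen_ffact; simpl; ring.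
- rewrite step, <- IH, (T0 l (S l)) by lia; simpl; ring.
Qed.

(* Main.v *)
(* The generating function at x is the one at 0 times c^(xt) = e^(x ln c t), so
   the Cauchy product gives
     M_n(x) = sum_l binom(n, n-l) (x ln c)^l M_(n-l)(0).
   Expanding x^l in generalized factorials and exchanging the two sums over
   0 <= j <= l <= n yields the formula.  The generating function need only be
   known on the punctured real interval around 0, which suffices to determine
   the Taylor coefficients. *)
Require Import Defs.
From Stdlib Require Import Reals Factorial Lra Lia.
From Coquelicot Require Import Coquelicot.
Open Scope C_scope.

(** By induction: the new row [S n] lengthens each column [j <= n] by one entry and opens the column
    [S n], which consists of its diagonal entry alone. *)
Lemma sum_n_triangle_switch {G : AbelianMonoid} (F : nat -> nat -> G) (n : nat) :
  sum_n (fun l => sum_n (F l) l) n =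
  sum_n (fun j => sum_n_m (fun l => F l j) j n) n.
Proof.
induction n as [|n IH].
- now rewrite !sum_O, sum_n_n.
- rewrite !sum_Sn, IH, sum_n_n, plus_assoc.
  f_equal; rewrite <- sum_n_plus.
  apply sum_n_ext_loc; intros j Hj; rewrite sum_n_Sm; [reflexivity | lia].
Qed.

Lemma pow_n_RtoC (t : R) (n : nat) :
  pow_n (K := C_AbsRing) (RtoC t) n = RtoC (t ^ n)%R.
Proof.
induction n as [|n IH]; [reflexivity|].
cbn [pow_n pow]; rewrite IH, RtoC_mult; reflexivity.
Qed.

Lemma Cmult_sum_n_m_l (z : C) (u : nat -> C) (n m : nat) :
  z * sum_n_m u n m = sum_n_m (fun k => z * u k) n m.
Proof. symmetry; exact (sum_n_m_mult_l (K := C_Ring) z u n m). Qed.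

Lemma linear_sum_n {K : AbsRing} {U V : NormedModule K} (p : U -> V) :
  is_linear p -> forall (u : nat -> U) (n : nat),
    p (sum_n u n) = sum_n (fun k => p (u k)) n.
Proof.
intros Hp u n; induction n as [|n IH].
- now rewrite !sum_O.
- now rewrite !sum_Sn, (linear_plus p Hp), IH.
Qed.

(** At a real point the powers of [t] are real scalars, so [p] passes through the partial sums;
    being continuous, it passes to the limit. It serves for the real and imaginary parts. *)
Lemma is_pseries_linear (p : C_R_NormedModule -> R_NormedModule) :
  is_linear p -> forall (u : nat -> C) (t : R) (l : C),
    is_pseries (K := C_AbsRing) (V := C_NormedModule) u (RtoC t) l ->
    is_pseries (fun n => p (u n)) t (p l).
Proof.
intros Hp u t l H; unfold is_pseries, is_series in *.
apply (filterlim_ext (fun n => p (sum_n (fun k =>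
  scal (pow_n (K := C_AbsRing) (RtoC t) k) (u k : C_NormedModule)) n))).
- intros n; refine (eq_trans (linear_sum_n p Hp _ n) _).
  apply sum_n_ext; intros k.
  rewrite pow_n_pow, pow_n_RtoC.
  refine (eq_trans _ (linear_scal p Hp _ _)); f_equal.
  apply injective_projections; unfold scal; simpl; unfold mult, scal; simpl;
    unfold mult; simpl; ring.
- exact (filterlim_comp _ _ _ _ p _ _ _ H (linear_cont p l Hp)).
Qed.

(** The terms of a convergent series tend to 0, which fails beyond the radius. *)
Lemma CV_radius_ge (u : nat -> R) (t l : R) :
  is_pseries u t l -> Rbar_le (Rabs t) (CV_radius u).
Proof.
intros H; apply Rbar_not_lt_le; intros Hlt; apply (CV_disk_outside u t Hlt).
apply (is_lim_seq_ext (fun n => scal (pow_n (K := R_AbsRing) t n) (u n))).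
- intros n; rewrite pow_n_pow; apply Rmult_comm.
- apply ex_series_lim_0; now exists l.
Qed.

Lemma CV_radius_punctured_disk (u : nat -> R) (f : R -> R) (rho : R) :
  (0 < rho)%R -> (forall t, (0 < Rabs t < rho)%R -> is_pseries u t (f t)) ->
  Rbar_le rho (CV_radius u).
Proof.
intros Hrho H; destruct (Rbar_le_lt_dec rho (CV_radius u)) as [|Hlt]; auto.
exfalso; pose proof (CV_radius_ge_0 u) as H0.
destruct (CV_radius u) as [x| |] eqn:E; simpl in *; try lra; try tauto.
(* As [0 <= x < rho], the midpoint is a nonzero point of convergence that lies beyond the supposed
   radius [x]. *)
assert (Hm : (Rabs ((x + rho) / 2) = (x + rho) / 2)%R) by (apply Rabs_pos_eq; lra).
assert (Hle := CV_radius_ge _ _ _ (H ((x + rho) / 2)%R ltac:(lra))).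
rewrite E, Hm in Hle; simpl in Hle; lra.
Qed.

(** The n-th derivative at 0 of the sum is n! times the n-th coefficient, and it depends only on the
    values near 0. *)
Lemma pseries_unique (u v : nat -> R) (f : R -> R) (rho : R) :
  (0 < rho)%R ->
  (forall t, (0 < Rabs t < rho)%R -> is_pseries u t (f t)) ->
  (forall t, (0 < Rabs t < rho)%R -> is_pseries v t (f t)) ->
  forall n, u n = v n.
Proof.
intros Hrho Hu Hv n.
assert (pos : forall w, Rbar_le rho (CV_radius w) -> Rbar_lt 0 (CV_radius w))
  by (intros w; apply Rbar_lt_le_trans; exact Hrho).
pose proof (pos _ (CV_radius_punctured_disk u f rho Hrho Hu)) as Ru.
pose proof (pos _ (CV_radius_punctured_disk v f rho Hrho Hv)) as Rv.
assert (Heq : forall t, (0 < Rabs t < rho)%R -> PSeries u t = PSeries v t).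
{ intros t Ht.
  now rewrite (is_pseries_unique _ _ _ (Hu t Ht)), (is_pseries_unique _ _ _ (Hv t Ht)). }
assert (lim : forall w, Rbar_lt 0 (CV_radius w) ->
  is_lim (PSeries w) 0 (PSeries w 0)).
{ intros w Hw; apply is_lim_continuity, PSeries_continuity.
  now rewrite Rabs_R0. }
(* The hypotheses say nothing at 0, where equality follows by continuity. *)
assert (Heq0 : PSeries u 0 = PSeries v 0).
{ apply Rbar_finite_eq; rewrite <- (is_lim_unique _ _ _ (lim u Ru)).
  apply is_lim_unique; apply (is_lim_ext_loc (PSeries v)); [|exact (lim v Rv)].
  exists (mkposreal rho Hrho); intros t Ht Ht0; symmetry; apply Heq.
  split; [now apply Rabs_pos_lt|].
  generalize Ht; unfold ball; simpl; unfold AbsRing_ball, abs, minus, plus, opp; simpl.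
  now rewrite Ropp_0, Rplus_0_r. }
assert (HD : Derive_n (PSeries u) n 0 = Derive_n (PSeries v) n 0).
{ apply Derive_n_ext_loc; exists (mkposreal rho Hrho); intros t Ht.
  destruct (Req_dec t 0) as [->|Ht0]; [exact Heq0|].
  apply Heq; split; [now apply Rabs_pos_lt|].
  generalize Ht; unfold ball; simpl; unfold AbsRing_ball, abs, minus, plus, opp; simpl.
  now rewrite Ropp_0, Rplus_0_r. }
rewrite !Derive_n_coef in HD by assumption.
exact (Rmult_eq_reg_r _ _ _ HD (INR_fact_neq_0 n)).
Qed.

Lemma is_pseries_exp_scal (y t : R) :
  is_pseries (fun n => y ^ n / INR (fact n))%R t (exp (y * t)).
Proof.
eapply is_series_ext; [|exact (is_exp_Reals (y * t))].
intros n; rewrite !pow_n_pow; unfold scal; simpl; unfold mult; simpl.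
rewrite Rpow_mult_distr; unfold Rdiv; ring.
Qed.

Lemma CV_radius_exp_scal (y : R) :
  CV_radius (fun n => y ^ n / INR (fact n))%R = p_infty.
Proof.
pose proof (fun t => CV_radius_ge _ _ _ (is_pseries_exp_scal y t)) as H.
destruct (CV_radius _) as [x| |]; auto.
(* Convergence at [Rabs x + 1] rules out a finite radius [x]. *)
- specialize (H (Rabs x + 1)%R); simpl in H.
  pose proof (Rle_abs x); pose proof (Rle_abs (Rabs x + 1)); lra.
- now specialize (H 0%R).
Qed.

(* Restricted to the real axis, the real and imaginary parts are real power
   series, for which Cauchy products and uniqueness are available. *)
Lemma taylor_at_0_exp_mult (f g : C -> C) (u v : nat -> C) (y : R) :
  is_taylor_at_0 f u -> is_taylor_at_0 g v ->
  (forall t : R, g t = f t * RtoC (exp (y * t))) ->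
  forall n, v n =
    sum_n (fun l => Binomial.C n (n - l) * RtoC y ^ l * u (n - l)%nat) n.
Proof.
intros [r1 [Hr1 Hf]] [r2 [Hr2 Hg]] Hfg n.
(* Coefficients of the Cauchy product. The exponential factor enters as a real scalar, so that every
   real-linear [p] commutes with it. *)
set (w := fun n : nat =>
  sum_n (fun k => scal (y ^ k / INR (fact k))%R
                   (u (n - k)%nat / INR (fact (n - k)) : C_R_NormedModule)) n).
assert (Hpart : forall p : C_R_NormedModule -> R_NormedModule,
  is_linear p -> p (v n / INR (fact n)) = p (w n)).
{ intros p Hp.
  assert (Hrho : (0 < Rmin r1 r2)%R) by now apply Rmin_glb_lt.
  assert (Hf' : forall t : R, (0 < Rabs t < Rmin r1 r2)%R ->
    is_pseries (fun n => p (u n / INR (fact n))) t (p (f t))).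
  { intros t Ht; pose proof (Rmin_l r1 r2).
    apply (is_pseries_linear p Hp), Hf; rewrite Cmod_R; lra. }
  apply (pseries_unique (fun n => p (v n / INR (fact n))) (fun n => p (w n))
    (fun t => p (g t)) (Rmin r1 r2) Hrho).
  - intros t Ht; pose proof (Rmin_r r1 r2).
    apply (is_pseries_linear p Hp), Hg; rewrite Cmod_R; lra.
  - intros t Ht.
    assert (Hpg : p (g t) = (exp (y * t) * p (f t))%R).
    { change (exp (y * t) * p (f t))%R
        with (scal (exp (y * t)) (p (f t))).
      rewrite <- (linear_scal p Hp), Hfg; f_equal.
      apply injective_projections; unfold scal; simpl; unfold scal; simpl;
        unfold mult; simpl; ring. }
    rewrite Hpg.
    eapply is_pseries_ext; [|apply is_pseries_mult;
      [exact (is_pseries_exp_scal y t) | exact (Hf' t Ht) | |]].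
    + intros k; unfold PS_mult, w; rewrite (linear_sum_n p Hp), sum_n_Reals.
      apply sum_eq; intros i Hi; now rewrite (linear_scal p Hp).
    + now rewrite CV_radius_exp_scal.
    + eapply Rbar_lt_le_trans; [|exact (CV_radius_punctured_disk _ _ _ Hrho Hf')].
      exact (proj2 Ht). }
assert (Hn : forall i, RtoC (INR (fact i)) <> 0)
  by (intros i E; apply (INR_fact_neq_0 i); now apply RtoC_inj).
assert (E : v n / INR (fact n) = w n).
{ apply injective_projections;
    [apply (Hpart fst), is_linear_fst | apply (Hpart snd), is_linear_snd]. }
replace (v n) with (RtoC (INR (fact n)) * (v n / INR (fact n)))
  by (field; apply Hn).
rewrite E; unfold w.
refine (eq_trans (Cmult_sum_n_m_l _ _ 0 n) _).
apply sum_n_m_ext_loc; intros l Hl.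
(* What remains is [n! / (l! (n-l)!)] on both sides; [l <= n] matters because subtraction is
   truncated. *)
unfold Binomial.C; replace (n - (n - l))%nat with l by lia.
rewrite RtoC_div, RtoC_mult, <- RtoC_pow
  by (apply Rmult_integral_contrapositive; split; apply INR_fact_neq_0).
replace (scal (y ^ l / INR (fact l))%R
  (u (n - l)%nat / INR (fact (n - l)) : C_R_NormedModule))
  with (RtoC (y ^ l) / RtoC (INR (fact l)) * (u (n - l)%nat / INR (fact (n - l)))).
- unfold mult; simpl; field; auto.
- rewrite <- RtoC_div by apply INR_fact_neq_0.
  apply injective_projections; unfold scal; simpl; unfold scal; simpl;
    unfold mult; simpl; ring.
Qed.

Lemma Cexp_RtoC (y : R) : Cexp y = exp y.
Proof.
unfold Cexp; simpl; rewrite cos_0, sin_0; unfold RtoC; f_equal; ring.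
Qed.

(** Only the factor [c^(xt)] depends on [x], and it is 1 at [x = 0]; for real [t] it is a real
    exponential. *)
Lemma M_genfun_exp (m r k : nat) (a b c : R) (alpha : nat -> C) (x t : R) :
  M_genfun m r k a b c alpha x t
  = M_genfun m r k a b c alpha 0 t * RtoC (exp (x * ln c * t)).
Proof.
unfold M_genfun, Rpow_C.
rewrite <- !RtoC_mult, !Cexp_RtoC, !Rmult_0_l, exp_0.
replace (x * t * ln c)%R with (x * ln c * t)%R by ring.
unfold Cdiv; ring.
Qed.

Theorem theorem4p1 (a b c : R) (m k r : nat) (alpha : nat -> C)
  (ha : (0 < a)%R) (hb : (0 < b)%R) (hc : (0 < c)%R) (hab : a <> b)
  (hm : (0 < m)%nat) (hr : (0 < r)%nat)
  (han : forall x : R, analytic_at_0 (M_genfun m r k a b c alpha x)) :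
  forall (x : R) (n : nat),
    M_poly m r k a b c alpha n x =
    sum_n (fun j =>
      gen_ffact alpha x j *
      sum_n_m (fun l =>
        Binomial.C n (n - l) * ln c ^ l * gen_stirling2 alpha l j
        * M_num m r k a b c alpha (n - l)) j n) n.
Proof.
intros x n; unfold M_num, M_poly.
rewrite (taylor_at_0_exp_mult _ _ _ _ (x * ln c)
  (taylor_coeffP _ (han 0%R)) (taylor_coeffP _ (han x)) (M_genfun_exp _ _ _ _ _ _ _ x)).
set (M := taylor_coeff _).
(* The common summand of both double sums, with [l] the power of [x] and [j] the order of the
   factorial. *)
set (F := fun l j => gen_ffact alpha x j *
  (Binomial.C n (n - l) * ln c ^ l * gen_stirling2 alpha l j * M (n - l)%nat)).
transitivity (sum_n (fun l => sum_n (F l) l) n).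
- apply sum_n_ext; intros l.
  replace (RtoC (x * ln c) ^ l) with (RtoC (ln c) ^ l * RtoC x ^ l)
    by (rewrite <- !RtoC_pow, <- RtoC_mult, <- Rpow_mult_distr, (Rmult_comm x); reflexivity).
  rewrite (gen_stirling2P alpha l x).
  rewrite Cmult_assoc, <- Cmult_assoc, (Cmult_comm _ (M _)), Cmult_assoc.
  unfold sum_n; rewrite Cmult_sum_n_m_l.
  apply sum_n_m_ext; intros j; unfold F.
  (* The equality is stated in the carrier of a monoid structure; [ring] needs it over [C]. *)
  match goal with |- ?x = ?y => change (@eq C x y) end; ring.
- rewrite sum_n_triangle_switch; apply sum_n_ext; intros j.
  symmetry; apply Cmult_sum_n_m_l.
Qed.
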